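(* Let $V=\{f_1=\cdots=f_r=0\}\subset(\mathbb C^\ast)^n$ be a smooth complete intersection of codimension $r$ with $2r\le n$. A point $z\in V$ is critical for $\operatorname{Log}|_V$ if and only if $$\operatorname{rank}_{\mathbb R}\mathcal M_f(z)\le 2r-1.$$
   Context: $\operatorname{Log}:(\mathbb C^\ast)^n\to\mathbb R^n$ is $\operatorname{Log}(z)=(\log|z_1|,\dots,\log|z_n|)$. The $f_j$ are Laurent polynomials; $V$ is a smooth complete intersection of codimension $r$ means that $df_1,\dots,df_r$ are $\mathbb C$-linearly independent at every point of $V$. A point $z\in V$ is critical for $\operatorname{Log}|_V$ if the real rank of $d_z(\operatorname{Log}|_V):T_zV\to\mathbb R^n$ is less than $n$. Let $g_{ji}(z)=z_i\,\partial f_j/\partial z_i(z)=u_{ji}(z)+i\,v_{ji}(z)$ with $u_{ji},v_{ji}$ real, $1\le j\le r$, $1\le i\le n$. $\mathcal M_f(z)$ is the real $n\times 2r$ matrix whose $i$-th row is $(v_{1i},\dots,v_{ri},u_{1i},\dots,u_{ri})$. *)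

(* Defs.v *)
From HB Require Import structures.
From mathcomp Require Import all_boot all_order all_algebra.
From mathcomp Require Import finmap.
From mathcomp Require Import all_classical all_reals all_analysis.
From mathcomp Require Import complex.

Set Implicit Arguments.
Unset Strict Implicit.
Unset Printing Implicit Defensive.

Import Order.TTheory GRing.Theory Num.Theory.
Import numFieldNormedType.Exports.

Local Open Scope classical_set_scope.
Local Open Scope ring_scope.

(* R[i] is wrapped as an element of a structure type because MathComp-Analysis
   attaches the topology and norm of a field to [K : numFieldType], not to the
   bare carrier R[i]. *)
Definition Cx (R : realType) : numClosedFieldType := R[i].

(* A Laurent polynomial is the finitely supported family of its coefficients,
   indexed by exponent vectors in Z^n. *)
Definition laurent (R : realType) (n : nat) :=
  {fsfun {ffun 'I_n -> int} -> Cx R with 0}.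

Definition leval (R : realType) (n : nat) (p : laurent R n)
    (z : 'rV[Cx R]_n) : Cx R :=
  \sum_(m <- finsupp p) p m * \prod_(i < n) z 0 i ^ m i.

Definition torus (R : realType) (n : nat) : set 'rV[Cx R]_n :=
  [set z | forall i, z 0 i != 0].

Definition variety (R : realType) (n r : nat) (f : 'I_r -> laurent R n) :
    set 'rV[Cx R]_n :=
  [set z | torus z /\ forall j, leval (f j) z = 0].

(* ['d] is taken over the field Cx R: it is the holomorphic differential. *)
Definition smooth_complete_intersection (R : realType) (n r : nat)
    (f : 'I_r -> laurent R n) : Prop :=
  forall z, variety f z ->
    forall c : 'I_r -> Cx R,
      (forall w : 'rV[Cx R]_n, \sum_j c j * 'd (leval (f j)) z w = 0) ->
      forall j, c j = 0.

(* C^n as the real vector space R^n x R^n, via z = x + i y. *)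
Definition complexify (R : realType) (n : nat)
    (p : 'rV[R]_n * 'rV[R]_n) : 'rV[Cx R]_n :=
  \row_i ((p.1 0 i +i* p.2 0 i)%C : Cx R).

Definition realify (R : realType) (n : nat) (z : 'rV[Cx R]_n) :
    'rV[R]_n * 'rV[R]_n :=
  (\row_i complex.Re (z 0 i), \row_i complex.Im (z 0 i)).

Lemma complexifyK (R : realType) (n : nat) :
  cancel (@complexify R n) (@realify R n).
Proof. by case=> x y; congr pair; apply/rowP => i; rewrite !mxE. Qed.

Lemma realifyK (R : realType) (n : nat) :
  cancel (@realify R n) (@complexify R n).
Proof. by move=> z; apply/rowP => i; rewrite !mxE; case: (z 0 i). Qed.

Lemma complexifyZD (R : realType) (n : nat) (a : R)
    (p q : 'rV[R]_n * 'rV[R]_n) :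
  complexify (a *: p + q) = (a%:C%C : Cx R) *: complexify p + complexify q.
Proof.
apply/rowP => i; rewrite !mxE; apply/eqP; rewrite eq_complex /=.
by rewrite !mul0r subr0 addr0 !eqxx.
Qed.

Lemma realifyZD (R : realType) (n : nat) (a : R) (z w : 'rV[Cx R]_n) :
  realify ((a%:C%C : Cx R) *: z + w) = a *: realify z + realify w.
Proof. by rewrite -[z]realifyK -[w]realifyK -complexifyZD !complexifyK. Qed.

(* The real-linear map w |-> (d f_1 (w), ..., d f_r (w)) at z, in the real
   coordinates above. *)
Definition real_diff (R : realType) (n r : nat) (f : 'I_r -> laurent R n)
    (z : 'rV[Cx R]_n) (p : 'rV[R]_n * 'rV[R]_n) : 'rV[R]_r * 'rV[R]_r :=
  realify (\row_j 'd (leval (f j)) z (complexify p)).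

Lemma real_diff_is_linear (R : realType) (n r : nat)
    (f : 'I_r -> laurent R n) (z : 'rV[Cx R]_n) : linear (real_diff f z).
Proof.
move=> a p q; rewrite /real_diff -realifyZD; congr realify.
by apply/rowP => j; rewrite !mxE complexifyZD linearP.
Qed.

HB.instance Definition _ (R : realType) (n r : nat)
    (f : 'I_r -> laurent R n) (z : 'rV[Cx R]_n) :=
  GRing.isLinear.Build R ('rV[R]_n * 'rV[R]_n)%type ('rV[R]_r * 'rV[R]_r)%type
    _ (real_diff f z) (real_diff_is_linear f z).

Definition tangent_space (R : realType) (n r : nat) (f : 'I_r -> laurent R n)
    (z : 'rV[Cx R]_n) : {vspace 'rV[R]_n * 'rV[R]_n} :=
  lker (linfun (real_diff f z)).

Lemma tangent_spaceP (R : realType) (n r : nat) (f : 'I_r -> laurent R n)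
    (z : 'rV[Cx R]_n) (p : 'rV[R]_n * 'rV[R]_n) :
  p \in tangent_space f z <->
  forall j, 'd (leval (f j)) z (complexify p) = 0.
Proof.
rewrite memv_ker lfunE /= /real_diff; split=> [/eqP h j|h].
  move/(congr1 (@complexify _ _)): h; rewrite realifyK => /rowP/(_ j).
  by rewrite !mxE.
by apply/eqP; congr pair; apply/rowP => j; rewrite !mxE h.
Qed.

Definition Log (R : realType) (n : nat) (z : 'rV[Cx R]_n) : 'rV[R]_n :=
  \row_i ln (ComplexField.Normc.normc (z 0 i)).

(* The real differential of Log at z, as a linear map C^n = R^n x R^n -> R^n. *)
Definition dLog (R : realType) (n : nat) (z : 'rV[Cx R]_n) :
    'Hom(('rV[R]_n * 'rV[R]_n)%type, 'rV[R]_n) :=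
  linfun ('d (@Log R n \o @complexify R n) (realify z)).

Definition critical (R : realType) (n r : nat) (f : 'I_r -> laurent R n)
    (z : 'rV[Cx R]_n) : Prop :=
  (\dim (dLog z @: tangent_space f z)%VS < n)%N.

Definition log_partial (R : realType) (n r : nat) (f : 'I_r -> laurent R n)
    (z : 'rV[Cx R]_n) (j : 'I_r) (i : 'I_n) : Cx R :=
  z 0 i * 'D_'e_i (leval (f j)) z.

Definition Mf (R : realType) (n r : nat) (f : 'I_r -> laurent R n)
    (z : 'rV[Cx R]_n) : 'M[R]_(n, r + r) :=
  row_mx (\matrix_(i, j) complex.Im (log_partial f z j i))
         (\matrix_(i, j) complex.Re (log_partial f z j i)).

(* Main.v *)
From HB Require Import structures.
Require Import Defs.
From mathcomp Require Import all_boot all_order all_algebra.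
From mathcomp Require Import all_classical all_reals all_analysis.
From mathcomp Require Import complex ring zify.

(** The proof is a dimension count, best read in logarithmic coordinates: write
    a tangent vector w at z as w_i = z_i zeta_i. Since z lies in the torus this
    is a change of coordinates, in which the differential of Log becomes
    zeta |-> Re zeta ([dLogE]) and the differential of f_j becomes
    zeta |-> sum_i zeta_i g_ji.

    Let T be the tangent space at z. Complex independence of the df_j makes
    (df_1, ..., df_r) onto C^r, so T has real dimension 2n - 2r
    ([dim_tangent_space]). A vector of T is killed by dLog exactly when
    zeta = i eta with eta real and sum_i eta_i g_ji = 0 for all j. Splitting
    this equation into real and imaginary parts, eta is orthogonal to all the
    vectors (v_ji)_i and (u_ji)_i, that is, eta M_f(z) = 0. Hence the kernel of
    dLog on T is isomorphic to the left kernel of M_f(z) and has dimension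
    n - rank M_f(z) ([dim_tangent_lker_dLog]).

    By rank-nullity the rank of dLog on T is
      (2n - 2r) - (n - rank M_f(z)) = n - (2r - rank M_f(z)),
    which is less than n exactly when rank M_f(z) < 2r. *)

Set Implicit Arguments.
Unset Strict Implicit.
Unset Printing Implicit Defensive.

Import Order.TTheory GRing.Theory Num.Theory.
Import numFieldNormedType.Exports.

Local Open Scope ring_scope.

(** * Differentiability of Laurent polynomials *)

Lemma differentiable_prod (K : numFieldType) (V : normedModType K) (I : Type)
    (s : seq I) (P : pred I) (f : I -> V -> K) (x : V) :
  (forall i, differentiable (f i) x) ->
  differentiable (fun y => \prod_(i <- s | P i) f i y) x.
Proof.
move=> df; elim: s => [|i s IH].
  under eq_fun do rewrite big_nil; exact: differentiable_cst.
under eq_fun do rewrite big_cons; case: (P i) => //.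
exact: differentiableM.
Qed.

Lemma differentiable_bigsum (K : numFieldType) (V W : normedModType K)
    (I : Type) (s : seq I) (f : I -> V -> W) (x : V) :
  (forall i, differentiable (f i) x) ->
  differentiable (fun y => \sum_(i <- s) f i y) x.
Proof.
move=> df; elim: s => [|i s IH].
  under eq_fun do rewrite big_nil; exact: differentiable_cst.
under eq_fun do rewrite big_cons; exact: differentiableD.
Qed.

Lemma differentiable_exprz (K : numFieldType) (V : normedModType K)
    (f : V -> K) (m : int) (x : V) :
  f x != 0 -> differentiable f x -> differentiable (fun y => f y ^ m) x.
Proof.
move=> fx0 df; case: m => [[|m]|m].
- by under eq_fun do rewrite expr0z; exact: differentiable_cst.
- have -> : (fun y => f y ^ m.+1) = f ^+ m.+1.
    by apply/funext => y; rewrite exprfctE.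
  exact: differentiableX.
- have -> : (fun y => f y ^ Negz m) = fun y => ((f ^+ m.+1) y)^-1.
    by apply/funext => y; rewrite exprfctE.
  apply: differentiableV; last by rewrite exprfctE expf_neq0.
  exact: differentiableX.
Qed.

(** This is where the torus is needed: negative exponents make [leval p] a
    rational function with poles on the coordinate hyperplanes. Without
    differentiability the partial derivatives in [log_partial] would be
    unrelated to the differential used for the tangent space. *)
Lemma leval_differentiable (R : realType) (n : nat) (p : laurent R n)
    (z : 'rV[Cx R]_n) : torus z -> differentiable (leval p) z.
Proof.
move=> z0; apply: differentiable_bigsum => m.
apply: differentiableM; first exact: differentiable_cst.
apply: differentiable_prod => i; apply: differentiable_exprz => //.
exact: differentiable_coord.
Qed.

(** * The differential of Log *)

Lemma is_diff_coord (K : numFieldType) (n : nat) (M : 'rV[K]_n) i :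
  is_diff M (fun N : 'rV[K]_n => N 0 i) (fun N => N 0 i).
Proof.
apply: DiffDef; first exact: differentiable_coord.
have lin : linear (fun N : 'rV[K]_n => N 0 i) by move=> a u w; rewrite !mxE.
pose L := GRing.isLinear.Build _ _ _ _ _ lin.
pose c : {linear 'rV[K]_n -> K} := HB.pack (fun N : 'rV[K]_n => N 0 i) L.
by rewrite (@diff_lin _ _ _ c) //; apply: coord_continuous.
Qed.

(** Reduces a vector-valued map to its coordinates; applied to Log, whose
    coordinates are scalar functions covered by the chain rule. *)
Lemma differentiable_row (K : numFieldType) (V : normedModType K) (n : nat)
    (F : V -> 'rV[K]_n) (x : V) :
  (forall i, differentiable (fun y => F y 0 i) x) ->
  differentiable F x /\
  forall v i, 'd F x v 0 i = 'd (fun y => F y 0 i) x v.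
Proof.
move=> dF.
have FE : F = fun y => \sum_i F y 0 i *: 'e_i.
  by apply/funext => y; rewrite [LHS]row_sum_delta.
have dFx : differentiable F x.
  by rewrite FE; apply: differentiable_bigsum => i; apply: differentiableZl.
split=> // v i.
have := @diff_comp _ _ _ _ F (fun M : 'rV[K]_n => M 0 i) x dFx
  (differentiable_coord (F x) 0 i).
have [_ ->] := is_diff_coord (F x) i.
by move/(congr1 (@^~ v)).
Qed.

(** Trading the modulus for its square removes the square root, which is not
    differentiable at 0. The identity survives at 0 because both sides are then
    multiples of the default value [ln 0 = 0]. *)
Lemma Log_complexifyE (R : realType) (n : nat) (p : 'rV[R]_n * 'rV[R]_n) i :
  Log (complexify p) 0 i = 2^-1 * ln (p.1 0 i ^+ 2 + p.2 0 i ^+ 2).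
Proof.
rewrite !mxE /=; set s := _ + _.
have s0 : 0 <= s by rewrite addr_ge0 ?sqr_ge0.
have [->|/eqP sn0] := s =P 0; first by rewrite sqrtr0 ln0 // mulr0.
rewrite -[in RHS](sqr_sqrtr s0) lnXn ?sqrtr_gt0 ?lt_def ?sn0 //.
by rewrite -[ln _ *+ 2]mulr_natl mulKf ?pnatr_eq0.
Qed.

Lemma is_diff_fst (R : numFieldType) (V W : normedModType R) (p : V * W) :
  is_diff p fst fst.
Proof.
apply: DiffDef; first by apply/linear_differentiable => q; exact: cvg_fst.
by rewrite diff_lin // => q; exact: cvg_fst.
Qed.

Lemma is_diff_snd (R : numFieldType) (V W : normedModType R) (p : V * W) :
  is_diff p snd snd.
Proof.
apply: DiffDef; first by apply/linear_differentiable => q; exact: cvg_snd.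
by rewrite diff_lin // => q; exact: cvg_snd.
Qed.

Lemma is_diff_ln (R : realType) (x : R) :
  0 < x -> is_diff x (@ln R) (fun h => h * x^-1).
Proof.
move=> x0; have [dln ln'] := is_derive1_ln x0.
apply: DiffDef; first exact/derivable1_diffP.
by rewrite deriv1E // derive1E ln'.
Qed.

Lemma is_diff_Log_coord (R : realType) (n : nat) i (p : 'rV[R]_n * 'rV[R]_n) :
  0 < p.1 0 i ^+ 2 + p.2 0 i ^+ 2 ->
  is_diff p (fun q => Log (complexify q) 0 i)
   (fun q => (p.1 0 i * q.1 0 i + p.2 0 i * q.2 0 i) /
    (p.1 0 i ^+ 2 + p.2 0 i ^+ 2)).
Proof.
move=> s0.
have d1 := is_diff_comp (is_diff_fst p) (is_diff_coord p.1 i).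
have d2 := is_diff_comp (is_diff_snd p) (is_diff_coord p.2 i).
have ds := is_diffD (is_diffX 1 d1) (is_diffX 1 d2).
have dl := is_diffZ 2^-1 (is_diff_comp ds (is_diff_ln s0)).
have -> : (fun q => Log (complexify q) 0 i) = 2^-1 *: (@ln R \o
    (((fun N : 'rV[R]_n => N 0 i) \o fst) ^+ 2 +
     ((fun N : 'rV[R]_n => N 0 i) \o snd) ^+ 2)).
  by apply/funext => q; rewrite Log_complexifyE !fctE.
apply: (is_diff_eq dl); apply/funext => q /=.
rewrite !fctE /= /GRing.scale /=; field.
by rewrite gt_eqF.
Qed.

(** Log is the real part of the multivalued holomorphic logarithm, whose
    derivative in each coordinate is 1 / z_i. *)
Lemma dLogE (R : realType) (n : nat) (z : 'rV[Cx R]_n) q i : torus z ->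
  dLog z q 0 i = complex.Re (complexify q 0 i / z 0 i : R[i]).
Proof.
move=> z0; rewrite lfunE /=.
have s0 j : 0 < (realify z).1 0 j ^+ 2 + (realify z).2 0 j ^+ 2.
  have := z0 j; rewrite !mxE; case: (z 0 j) => a b /= ab0.
  rewrite lt_def paddr_eq0 ?sqr_ge0 // !sqrf_eq0 addr_ge0 ?sqr_ge0 // andbT.
  by move: ab0; rewrite eq_complex.
have [|_ ->] :=
  @differentiable_row _ _ n (@Log R n \o @complexify R n) (realify z).
  by move=> j; have [] := is_diff_Log_coord (s0 j).
have [_ ->] := is_diff_Log_coord (s0 i).
have := s0 i.
rewrite !mxE; case: (z 0 i) => a b /= ab0.
by field; rewrite gt_eqF.
Qed.

(** * Kernels of matrices and dimension of the tangent space *)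

(** Rank-nullity for a matrix acting on row vectors. Factoring [A] through its
    row base, which acts injectively, identifies the dimension of the image
    with [\rank A]. *)
Lemma dim_lker_mulmxr (F : fieldType) (m n : nat) (A : 'M[F]_(m, n)) :
  (\dim (lker (linfun (mulmxr A) : 'Hom('rV[F]_m, 'rV[F]_n))) + \rank A = m)%N.
Proof.
have im_rk : \dim (limg (linfun (mulmxr A) : 'Hom('rV[F]_m, 'rV[F]_n))) = \rank A.
  pose g : 'Hom('rV[F]_(\rank A), 'rV[F]_n) := linfun (mulmxr (row_base A)).
  have -> : limg (linfun (mulmxr A) : 'Hom('rV[F]_m, 'rV[F]_n)) = limg g.
    apply/vspaceP => y; apply/memv_imgP/memv_imgP => [] [x _ ->{y}].
      exists (x *m col_base A); first exact: memvf.
      by rewrite !lfunE /= -mulmxA mulmx_base.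
    have /row_fullP[B BA] := col_base_full A.
    exists (x *m B); first exact: memvf.
    have {}BA : B *m A = row_base A.
      have := congr1 (mulmx^~ (row_base A)) BA.
      by rewrite -mulmxA mulmx_base mul1mx.
    by rewrite !lfunE /= -mulmxA BA.
  rewrite limg_dim_eq; first by rewrite dimvf; exact: mul1n.
  have /eqP-> : lker g == 0%VS; [|exact: capv0].
  apply/lker0P => x y.
  rewrite !lfunE /=; exact/row_free_inj/row_base_free.
rewrite -im_rk -[lker _]capfv limg_ker_dim dimvf; exact: mul1n.
Qed.

Lemma dim_fullv_pair (R : realType) (m : nat) :
  \dim (fullv : {vspace 'rV[R]_m * 'rV[R]_m}) = (m + m)%N.
Proof. by rewrite dimvf; change (1 * m + 1 * m = m + m)%N; rewrite !mul1n. Qed.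

Lemma diff_levalE (R : realType) (n : nat) (p : laurent R n)
    (z w : 'rV[Cx R]_n) :
  'd (leval p) z w = \sum_i w 0 i * 'd (leval p) z 'e_i.
Proof.
rewrite {1}[w]row_sum_delta linear_sum.
by apply: eq_bigr => i _; rewrite linearZ.
Qed.

(** Linear independence of the df_j says that the complex Jacobian matrix is
    row-free; a right inverse of it then gives a preimage of every vector of
    C^r, so the map cutting out the tangent space is onto a space of real
    dimension 2r. *)
Lemma dim_tangent_space (R : realType) (n r : nat) (f : 'I_r -> laurent R n)
    (z : 'rV[Cx R]_n) :
  (forall c : 'I_r -> Cx R,
      (forall w : 'rV[Cx R]_n, \sum_j c j * 'd (leval (f j)) z w = 0) ->
      forall j, c j = 0) ->
  (\dim (tangent_space f z) + 2 * r = 2 * n)%N.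
Proof.
move=> indep.
pose D : 'M[Cx R]_(r, n) := \matrix_(j, i) 'd (leval (f j)) z 'e_i.
have /row_freeP[B DB] : row_free D.
  apply: inj_row_free => c cD; apply/rowP => j; rewrite mxE.
  apply: (indep (fun j => c 0 j)) => w.
  under eq_bigr do rewrite diff_levalE mulr_sumr.
  rewrite exchange_big big1 // => i _ /=.
  move/rowP: cD => /(_ i); rewrite !mxE => cDi.
  under eq_bigr do rewrite mulrCA.
  transitivity (w 0 i * \sum_k c 0 k * D k i); last by rewrite cDi mulr0.
  by rewrite -mulr_sumr; congr (_ * _); apply: eq_bigr => k _; rewrite mxE.
have surj : limg (linfun (real_diff f z)) = fullv.
  apply/vspaceP => y; rewrite memvf; apply/memv_imgP.
  exists (realify (complexify y *m B^T)); first exact: memvf.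
  rewrite lfunE /= /real_diff realifyK -[LHS]complexifyK; congr realify.
  apply/rowP => j; rewrite [RHS]mxE diff_levalE.
  have /(congr1 (fun M => ((M *m (complexify y)^T) j 0))) := DB.
  rewrite mul1mx -mulmxA [in RHS]mxE => <-.
  rewrite mxE; apply: eq_bigr => i _.
  by rewrite mulrC [D j i]mxE -[B in LHS]trmxK -trmx_mul mxE.
have := limg_ker_dim (linfun (real_diff f z)) fullv.
by rewrite surj capfv !dim_fullv_pair !addnn !mul2n.
Qed.

(** * Tangent vectors killed by the differential of Log *)

(** The velocity at t = 0 of t |-> (z_i exp(i t eta_i))_i, which keeps all the
    moduli constant. *)
Definition angular (R : realType) (n : nat) (z : 'rV[Cx R]_n) (eta : 'rV[R]_n) :
    'rV[R]_n * 'rV[R]_n :=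
  realify (\row_i (z 0 i * (0 +i* eta 0 i)%C : Cx R)).

Lemma angular_is_linear (R : realType) (n : nat) (z : 'rV[Cx R]_n) :
  linear (angular z).
Proof.
move=> a u v; rewrite /angular -realifyZD; congr realify.
apply/rowP => i; rewrite !mxE; case: (z 0 i) => x y.
by apply/eqP; rewrite eq_complex /=; apply/andP; split; apply/eqP; ring.
Qed.

HB.instance Definition _ (R : realType) (n : nat) (z : 'rV[Cx R]_n) :=
  GRing.isLinear.Build R 'rV[R]_n ('rV[R]_n * 'rV[R]_n)%type
    _ (angular z) (angular_is_linear z).

Lemma angular_inj (R : realType) (n : nat) (z : 'rV[Cx R]_n) :
  torus z -> injective (angular z).
Proof.
move=> z0 u v /(can_inj (@realifyK R n)) /rowP uv; apply/rowP => i.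
by have := uv i; rewrite !mxE => /(mulfI (z0 i)) [].
Qed.

Lemma sum_imag (R : realType) (n : nat) (eta : 'rV[R]_n) (g : 'I_n -> Cx R) :
  \sum_i ((0 +i* eta 0 i)%C : Cx R) * g i =
  ((- \sum_i eta 0 i * complex.Im (g i)) +i*
     \sum_i eta 0 i * complex.Re (g i))%C.
Proof.
elim/big_rec3: _ => [|i x y w _ ->]; first by rewrite oppr0.
case: (g i) => a b; apply/eqP; rewrite eq_complex /=.
by apply/andP; split; apply/eqP; ring.
Qed.

(** On an angular direction, df_j is i sum_k eta_k g_jk. Its real part pairs
    eta with a column of the left block of [Mf] (up to sign), its imaginary part
    with a column of the right block. *)
Lemma diff_leval_angular (R : realType) (n r : nat) (f : 'I_r -> laurent R n)
    (z : 'rV[Cx R]_n) (eta : 'rV[R]_n) : torus z ->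
  (forall j, 'd (leval (f j)) z (complexify (angular z eta)) = 0) <->
  eta *m Mf f z = 0.
Proof.
move=> z0.
have dE j : 'd (leval (f j)) z (complexify (angular z eta)) =
    ((- \sum_i eta 0 i * complex.Im (log_partial f z j i)) +i*
     \sum_i eta 0 i * complex.Re (log_partial f z j i))%C.
  rewrite -sum_imag diff_levalE realifyK; apply: eq_bigr => i _.
  rewrite mxE /log_partial deriveE; last exact: leval_differentiable.
  by rewrite mulrCA mulrA.
rewrite /Mf mul_mx_row; split=> [h|].
  have {}h j := etrans (esym (dE j)) (h j).
  apply/eqP; rewrite row_mx_eq0; apply/andP; split; apply/eqP/rowP => j;
    have [re im] := h j; rewrite !mxE; under eq_bigr do rewrite mxE.
    by apply: oppr_inj; rewrite oppr0.
  exact: im.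
move/eqP; rewrite row_mx_eq0 => /andP[/eqP/rowP h1 /eqP/rowP h2] j.
rewrite dE; have := h1 j; have := h2 j; rewrite !mxE.
under eq_bigr do rewrite mxE; move=> ->.
by under eq_bigr do rewrite mxE; move=> ->; rewrite oppr0.
Qed.

(** A tangent vector is killed by dLog iff each quotient w_i / z_i is purely
    imaginary, i.e. iff it is an angular direction; [diff_leval_angular] then
    translates tangency. *)
Lemma tangent_lker_dLog (R : realType) (n r : nat) (f : 'I_r -> laurent R n)
    (z : 'rV[Cx R]_n) : torus z ->
  (tangent_space f z :&: lker (dLog z) =
   linfun (angular z) @: lker (linfun (mulmxr (Mf f z))))%VS.
Proof.
move=> z0; apply/vspaceP => p; apply/idP/memv_imgP.
  case/memv_capP => /tangent_spaceP pT; rewrite memv_ker => /eqP/rowP pL.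
  pose eta : 'rV[R]_n := \row_i complex.Im (complexify p 0 i / z 0 i : R[i]).
  have pE : p = angular z eta.
    apply: (can_inj (@complexifyK R n)); rewrite realifyK.
    apply/rowP => i; rewrite [RHS]mxE [eta 0 i]mxE.
    have reE : complex.Re (complexify p 0 i / z 0 i : R[i]) = 0.
      by rewrite -dLogE // pL [LHS]mxE.
    rewrite -[LHS](divfK (z0 i)) mulrC; congr (_ * _).
    by move: reE; case: (complexify p 0 i / z 0 i) => a b /= ->.
  exists eta; last by rewrite lfunE.
  rewrite memv_ker lfunE /=; apply/eqP/(diff_leval_angular _ _ z0) => j.
  by rewrite -pE.
case=> eta; rewrite memv_ker !lfunE /= => /eqP etaM ->.
apply/memv_capP; split.
  by apply/tangent_spaceP; apply/(diff_leval_angular _ _ z0).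
rewrite memv_ker; apply/eqP/rowP => i; rewrite dLogE // realifyK !mxE.
by rewrite mulrAC divff // mul1r.
Qed.

Lemma dim_tangent_lker_dLog (R : realType) (n r : nat) (f : 'I_r -> laurent R n)
    (z : 'rV[Cx R]_n) : torus z ->
  (\dim (tangent_space f z :&: lker (dLog z)) + \rank (Mf f z) = n)%N.
Proof.
move=> z0; rewrite tangent_lker_dLog // limg_dim_eq ?dim_lker_mulmxr //.
have /eqP-> : lker (linfun (angular z)) == 0%VS; last exact: capv0.
by apply/lker0P => u v; rewrite !lfunE; apply: angular_inj.
Qed.

(* The bound is compared in int so that 2 r - 1 is not truncated at r = 0. *)
Theorem lemma2p1 (R : realType) (n r : nat) (f : 'I_r -> laurent R n)
    (hr : (2 * r <= n)%N) (hf : smooth_complete_intersection f)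
    (z : 'rV[Cx R]_n) (hz : variety f z) :
  critical f z <-> (\rank (Mf f z))%:Z <= 2%:Z * r%:Z - 1.
Proof.
have [z0 _] := hz.
have dT := dim_tangent_space (hf z hz).
have dK := dim_tangent_lker_dLog f z0.
have := limg_ker_dim (dLog z) (tangent_space f z).
rewrite /critical; move: dT dK.
have arith (a b c d : nat) : (c + 2 * r = 2 * n)%N -> (b + d = n)%N ->
    (b + a = c)%N -> (a < n)%N <-> d%:Z <= 2%:Z * r%:Z - 1 by lia.
exact: arith.
Qed.
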